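(* Let $q$ and $r$ be two positive integers and $u_0$ be a non-negative integer. Let $(u_n)_{n \in \mathbb{N}}$ be the sequence of natural numbers whose general term is $u_n = r [n]_q + u_0$. Suppose that $\gcd(u_0, r) = \gcd(u_1, q) = 1$, and set $$A := \max\left(0, \frac{u_0 (q - 1) + 1 - r}{2 r}\right).$$ Then, for any positive integer $n$, we have $$\mathrm{lcm}\{u_1, u_2, \dots, u_n\} \geq u_1 \left(\frac{r + 1}{\sqrt{r}\,(A + 1)}\right)^{n - 1} q^{\frac{(n - 1)(n - 4)}{4}}.$$
   Context: $\mathbb{N}$ is the set of non-negative integers. For $n \in \mathbb{N}$, $[n]_q := \frac{q^n - 1}{q - 1}$ if $q \neq 1$ and $[n]_1 := n$. *)

(* Defs.v *)
From mathcomp Require Import all_boot all_order all_algebra.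
From mathcomp Require Import reals exp.

Set Implicit Arguments.
Unset Strict Implicit.
Unset Printing Implicit Defensive.

Import Order.TTheory GRing.Theory Num.Theory.

Local Open Scope nat_scope.

(* For q >= 2 both subtractions are untruncated and the quotient is exact;
   see [muln_qint]. The value at q = 0 is irrelevant. *)
Definition qint (q n : nat) : nat :=
  if q == 1 then n else (q ^ n - 1) %/ (q - 1).

Lemma muln_qint (q n : nat) : 0 < q -> (q - 1) * qint q n = q ^ n - 1.
Proof.
move=> q_gt0; rewrite /qint; case: eqP => [->|_]; first by rewrite exp1n.
by rewrite mulnC divnK // -[X in _ ^ n - X](exp1n n) subn_exp dvdn_mulr.
Qed.

Definition useq (q r u0 n : nat) : nat := r * qint q n + u0.

Local Open Scope ring_scope.

Definition Abound (R : realType) (q r u0 : nat) : R :=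
  Num.max 0 ((u0%:R * (q%:R - 1) + 1 - r%:R) / (2 * r%:R)).

(* Main.v *)
(* As u_(k+m) - u_k = r q^k [m]_q and every u_j with j >= 1 is prime to r q, an
   induction on m shows that u_k ... u_(k+m) divides L [m]_q! for every common
   multiple L of these terms.  So lcm {u_1, ..., u_n} >= u_k ... u_n / [n-k]_q!
   for each 1 <= k <= n, and it remains to choose k.  Since A >= 0, it is enough
   to treat A = 0.
   For q = 1, k can be adjusted as n grows so that the bound gains a factor at
   least r + 1 at each step, whence lcm >= u_1 (r + 1)^(n-1).
   For q >= 2, k = n - m with m = n/2 rounded down gives
   lcm >= u_1 r^m q^(m(n-m)), because u_(k+i) >= r q^k [i]_q; this suffices as
   (r + 1) / sqrt r <= 2 sqrt r <= q sqrt r. *)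
Require Import Defs.
From mathcomp Require Import all_boot all_order all_algebra.
From mathcomp Require Import reals exp.
From mathcomp Require Import zify ring lra.

Set Implicit Arguments.
Unset Strict Implicit.
Unset Printing Implicit Defensive.

Import Order.TTheory GRing.Theory Num.Theory.

Local Open Scope nat_scope.

Lemma qint1n (n : nat) : qint 1 n = n.
Proof. by []. Qed.

Lemma qintD (q k i : nat) : 0 < q ->
  qint q (k + i) = qint q k + q ^ k * qint q i.
Proof.
move=> q_gt0; have [->|q_neq1] := eqVneq q 1; first by rewrite !qint1n exp1n mul1n.
have q1_gt0 : 0 < q - 1 by lia.
(* Multiplying by q - 1 clears the quotients: q^(k+i) - 1 = (q^k - 1) + q^k (q^i - 1). *)
apply/eqP; rewrite -(eqn_pmul2l q1_gt0) mulnDr mulnCA !muln_qint // expnD.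
have := expn_gt0 q k; have := expn_gt0 q i; rewrite q_gt0 /= => hi hk.
apply/eqP; nia.
Qed.

Lemma qint1 (q : nat) : 0 < q -> qint q 1 = 1.
Proof.
move=> q_gt0; rewrite /qint; case: eqP => // q_neq1.
by rewrite expn1 divnn; have -> : 0 < q - 1 by lia.
Qed.

Lemma qint_gt0 (q n : nat) : 0 < q -> 0 < n -> 0 < qint q n.
Proof.
by case: n => // n q_gt0 _; rewrite -[n.+1]add1n qintD // qint1.
Qed.

Definition qfact (q n : nat) : nat := \prod_(i < n) qint q i.+1.

Lemma qfact_gt0 (q n : nat) : 0 < q -> 0 < qfact q n.
Proof. by move=> q_gt0; apply: prodn_gt0 => i; apply: qint_gt0. Qed.

Lemma qfactS (q n : nat) : qfact q n.+1 = qfact q n * qint q n.+1.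
Proof. exact: big_ord_recr. Qed.

Lemma useqD (q r u0 k m : nat) : 0 < q ->
  useq q r u0 (k + m) = useq q r u0 k + r * q ^ k * qint q m.
Proof. by move=> q_gt0; rewrite /useq qintD // mulnDr addnAC mulnA. Qed.

Lemma useq_le (q r u0 i j : nat) : 0 < q -> i <= j ->
  useq q r u0 i <= useq q r u0 j.
Proof. by move=> q_gt0 /subnKC <-; rewrite useqD // leq_addr. Qed.

Lemma coprime_useq_r (q r u0 k : nat) : gcdn u0 r = 1 ->
  coprime (useq q r u0 k) r.
Proof. by move=> co; rewrite coprime_sym /useq mulnC /coprime gcdnMDl gcdnC co. Qed.

(** Since u_(k+1) = u_1 + r q [k]_q, every term of positive index is congruent to u_1 modulo q. *)
Lemma coprime_useq_q (q r u0 k : nat) : 0 < q ->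
  gcdn (useq q r u0 1) q = 1 -> coprime (useq q r u0 k.+1) q.
Proof.
move=> q_gt0 co; rewrite -[k.+1]add1n useqD // expn1 mulnAC addnC.
by rewrite coprime_sym /coprime gcdnMDl gcdnC co.
Qed.

Definition uprod (q r u0 k m : nat) : nat := \prod_(i < m.+1) useq q r u0 (k + i).

Lemma uprodSr (q r u0 k m : nat) :
  uprod q r u0 k m.+1 = uprod q r u0 k m * useq q r u0 (k + m.+1).
Proof. exact: big_ord_recr. Qed.

Lemma uprodSl (q r u0 k m : nat) :
  uprod q r u0 k m.+1 = useq q r u0 k * uprod q r u0 k.+1 m.
Proof.
rewrite /uprod big_ord_recl addn0; congr (_ * _).
by apply: eq_bigr => i _; rewrite addSnnS.
Qed.

(** With N = L [m]_q!, the induction hypothesis at k and at k + 1 makes u_k ... u_(k+m+1) divide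
    both u_(k+m+1) N and u_k N, hence their difference r q^k [m+1]_q N. Coprimality then removes r
    q^k. *)
Lemma dvdn_uprod (q r u0 : nat) : 0 < q -> gcdn u0 r = 1 ->
  gcdn (useq q r u0 1) q = 1 ->
  forall m k L : nat, 0 < k ->
  (forall i, i <= m -> useq q r u0 (k + i) %| L) ->
  uprod q r u0 k m %| L * qfact q m.
Proof.
move=> q_gt0 co_r co_q; elim=> [|m IHm] k L k_gt0 dvL.
  by rewrite /uprod big_ord1 dvdn_mulr // dvL.
have dv_l : uprod q r u0 k m.+1 %| useq q r u0 (k + m.+1) * (L * qfact q m).
  rewrite uprodSr mulnC dvdn_mul //; apply: IHm => // i le_im.
  exact/dvL/leqW.
have dv_r : uprod q r u0 k m.+1 %| useq q r u0 k * (L * qfact q m).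
  rewrite uprodSl dvdn_mul //; apply: IHm => // i le_im.
  by rewrite addSnnS; apply: dvL.
have co : coprime (uprod q r u0 k m.+1) (r * q ^ k).
  apply: (big_ind (fun x => coprime x _)) => [|x y cox coy|i _].
  - exact: coprime1n.
  - by rewrite coprimeMl cox.
  - rewrite coprimeMr coprime_useq_r //=.
    (* Here k > 0 matters: u_0 itself may share a factor with q. *)
    by rewrite coprimeXr // -(prednK k_gt0) addSn coprime_useq_q.
move: dv_l; rewrite useqD // mulnDl dvdn_addr // -mulnA Gauss_dvdr //.
by rewrite qfactS mulnCA [qfact _ _ * _]mulnC.
Qed.

Lemma biglcmn_gt0 (F : nat -> nat) (m n : nat) :
  (forall i, m <= i -> 0 < F i) -> 0 < \big[lcmn/1]_(m <= i < n) F i.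
Proof.
move=> F_gt0; rewrite big_seq; apply: (big_ind (fun x => 0 < x)) => //.
  by move=> x y x_gt0 y_gt0; rewrite lcmn_gt0 x_gt0.
by move=> i; rewrite mem_index_iota => /andP[/F_gt0].
Qed.

Lemma dvdn_biglcmn_nat (F : nat -> nat) (m n j : nat) : m <= j < n ->
  F j %| \big[lcmn/1]_(m <= i < n) F i.
Proof.
move=> j_mn; rewrite (bigD1_seq j) ?iota_uniq ?mem_index_iota //=.
exact: dvdn_lcml.
Qed.

Lemma uprod_le_lcm (q r u0 k m : nat) : 0 < q -> 0 < r -> gcdn u0 r = 1 ->
  gcdn (useq q r u0 1) q = 1 -> 0 < k ->
  uprod q r u0 k m <=
    (\big[lcmn/1]_(1 <= i < (k + m).+1) useq q r u0 i) * qfact q m.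
Proof.
move=> q_gt0 r_gt0 co_r co_q k_gt0; apply: dvdn_leq.
  rewrite muln_gt0 qfact_gt0 // andbT biglcmn_gt0 // => i i_gt0.
  by rewrite addn_gt0 muln_gt0 r_gt0 qint_gt0.
apply: dvdn_uprod => // i le_im.
by apply: dvdn_biglcmn_nat; rewrite ltnS leq_add2l le_im addn_gt0 k_gt0.
Qed.

(* The constraint [k + m <= (r + 1) k + u0] is what makes appending
   [u_(k+m+1)] worth a factor [r + 1].  When it is tight, [u_k = m], so
   dropping [u_k] turns the bound for [(k, m)] into the one for [(k + 1, m - 1)]. *)
Lemma uprod1_lower (r u0 : nat) : 0 < r -> forall n : nat,
  exists k m : nat, [/\ 0 < k, k + m = n.+1, n.+1 <= r.+1 * k + u0
    & useq 1 r u0 1 * r.+1 ^ n * qfact 1 m <= uprod 1 r u0 k m].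
Proof.
move=> r_gt0.
have grow n k m : k + m = n.+1 -> n.+2 <= r.+1 * k + u0 ->
    useq 1 r u0 1 * r.+1 ^ n * qfact 1 m <= uprod 1 r u0 k m ->
    useq 1 r u0 1 * r.+1 ^ n.+1 * qfact 1 m.+1 <= uprod 1 r u0 k m.+1.
  move=> km le_n IH; rewrite uprodSr qfactS expnSr.
  (* As k + m = n + 1, this amounts to n + 2 <= (r + 1) k + u_0, which is [le_n]. *)
  have step : r.+1 * qint 1 m.+1 <= useq 1 r u0 (k + m.+1).
    by rewrite /useq !qint1n; nia.
  by apply: leq_trans (leq_mul IH step); rewrite !mulnA (mulnAC _ r.+1).
elim=> [|n [k [m [k_gt0 km le_n IH]]]].
  exists 1, 0; split=> //.
  by rewrite /uprod big_ord1 /qfact big_ord0 !muln1.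
have [le_n'|gt_n] := leqP n.+2 (r.+1 * k + u0).
  by exists k, m.+1; split=> //; [lia | apply: grow km _ IH].
have uk : useq 1 r u0 k = m by rewrite /useq qint1n; nia.
case: m km IH uk => [|m] km IH uk.
  by have := muln_gt0 r k; move: uk; rewrite /useq qint1n r_gt0 k_gt0; lia.
(* Passing to k + 1 raises the right side by r + 1, so the shortened product can be extended at
   once. *)
have le_n' : n.+2 <= r.+1 * k.+1 + u0 by nia.
exists k.+1, m.+1; split=> //; first by lia.
apply: grow le_n' _; first by lia.
move: IH; rewrite uprodSl uk qfactS qint1n mulnA mulnC.
by rewrite leq_pmul2l.
Qed.

Lemma lcm_lower1 (r u0 n : nat) : 0 < r -> gcdn u0 r = 1 ->
  useq 1 r u0 1 * r.+1 ^ n <= \big[lcmn/1]_(1 <= i < n.+2) useq 1 r u0 i.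
Proof.
move=> r_gt0 co_r; have [k [m [k_gt0 <- _ le]]] := uprod1_lower u0 r_gt0 n.
have fm_gt0 : 0 < qfact 1 m by exact: qfact_gt0.
rewrite -(leq_pmul2r fm_gt0); apply: leq_trans le _.
by apply: uprod_le_lcm => //; rewrite gcdn1.
Qed.

Lemma uprod_lower (q r u0 k m : nat) : 0 < q -> 0 < k ->
  useq q r u0 1 * r ^ m * q ^ (k * m) * qfact q m <= uprod q r u0 k m.
Proof.
move=> q_gt0 k_gt0; elim: m => [|m IHm].
  by rewrite muln0 /qfact big_ord0 /uprod big_ord1 addn0 !muln1 useq_le.
rewrite uprodSr qfactS expnSr mulnS expnD.
have step : r * q ^ k * qint q m.+1 <= useq q r u0 (k + m.+1).
  by rewrite useqD // leq_addl.
apply: leq_trans (leq_mul IHm step); apply: eq_leq; ring.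
Qed.

Lemma lcm_lower (q r u0 k m : nat) : 0 < q -> 0 < r -> gcdn u0 r = 1 ->
  gcdn (useq q r u0 1) q = 1 -> 0 < k ->
  useq q r u0 1 * r ^ m * q ^ (k * m) <=
    \big[lcmn/1]_(1 <= i < (k + m).+1) useq q r u0 i.
Proof.
move=> q_gt0 r_gt0 co_r co_q k_gt0; rewrite -(leq_pmul2r (qfact_gt0 m q_gt0)).
by apply: leq_trans (uprod_lower _ _ _ _ _) (uprod_le_lcm _ _ _ _ _ _).
Qed.

Local Open Scope ring_scope.

(** This is the reduction to A = 0; the lower bound 0 allows the comparison to be raised to a
    power. *)
Lemma Abound_base_le (R : realType) (q r u0 : nat) : (0 < r)%N ->
  0 <= (r%:R + 1) / (Num.sqrt r%:R * (Abound R q r u0 + 1))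
    <= (r%:R + 1) / Num.sqrt r%:R.
Proof.
move=> r_gt0; have A_ge0 : 0 <= Abound R q r u0 by rewrite le_max lexx.
have s_gt0 : 0 < Num.sqrt r%:R :> R by rewrite sqrtr_gt0 ltr0n.
have A1 : 1 <= Abound R q r u0 + 1 by lra.
have r1 : 0 <= r%:R + 1 :> R by rewrite natr1 ler0n.
have sA : Num.sqrt r%:R <= Num.sqrt r%:R * (Abound R q r u0 + 1).
  by rewrite ler_peMr // ltW.
have sA_gt0 := lt_le_trans s_gt0 sA.
rewrite divr_ge0 ?(ltW sA_gt0) //=.
by rewrite ler_wpM2l // lef_pV2.
Qed.

Theorem theorem1p2 (R : realType) (q r u0 : nat)
    (q_gt0 : (0 < q)%N) (r_gt0 : (0 < r)%N)
    (co_u0_r : gcdn u0 r = 1%N)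
    (co_u1_q : gcdn (useq q r u0 1) q = 1%N)
    (n : nat) (n_gt0 : (0 < n)%N) :
  (\big[lcmn/1%N]_(1 <= i < n.+1) useq q r u0 i)%:R >=
    (useq q r u0 1)%:R
    * ((r%:R + 1) / (Num.sqrt r%:R * (Abound R q r u0 + 1))) ^+ (n - 1)
    * q%:R `^ ((n%:R - 1) * (n%:R - 4) / 4) :> R.
Proof.
have /andP[B_ge0 B_le] := Abound_base_le R q u0 r_gt0.
set B := _ / (_ * _) in B_ge0 B_le *.
have s1 : 1 <= Num.sqrt r%:R :> R by rewrite -[leLHS]sqrtr1 ler_wsqrtr // ler1n.
have s_gt0 : 0 < Num.sqrt r%:R :> R by lra.
have ss : Num.sqrt r%:R * Num.sqrt r%:R = r%:R :> R.
  by rewrite -expr2 sqr_sqrtr ?ler0n.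
(* From here on [n] is the former n - 1, so the exponent of q is n (n - 3) / 4. *)
case: n n_gt0 => // n _; rewrite subn1 /=.
have [q1|q_neq1] := eqVneq q 1%N.
  subst q; rewrite powR1 mulr1.
  have := lcm_lower1 n r_gt0 co_u0_r; rewrite -(ler_nat R); apply: le_trans.
  rewrite natrM ler_wpM2l ?ler0n // natrX.
  apply: lerXn2r; rewrite ?nnegrE ?ler0n //.
  apply: le_trans B_le _; rewrite ler_pdivrMr // -natr1.
  by rewrite ler_peMr // natr1 ler0n.
have q2 : (2 <= q)%N by lia.
set m := (n.+1)./2; set k := (n.+1 - m)%N.
have [k_gt0 kmE] : (0 < k)%N /\ (k + m)%N = n.+1 by rewrite /k /m; lia.
have := lcm_lower m q_gt0 r_gt0 co_u0_r co_u1_q k_gt0.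
rewrite kmE -(ler_nat R); apply: le_trans.
rewrite !natrM -!mulrA ler_wpM2l ?ler0n // !natrX.
have B_le' : B <= q%:R * Num.sqrt r%:R.
  apply: le_trans B_le _; rewrite ler_pdivrMr // -mulrA ss.
  have : 2 <= q%:R :> R by rewrite ler_nat.
  have : 1 <= r%:R :> R by rewrite ler1n.
  by nra.
have Bn : B ^+ n <= r%:R ^+ m * q%:R ^+ n.
  apply: (@le_trans _ _ ((q%:R * Num.sqrt r%:R) ^+ n)).
    by apply: lerXn2r; rewrite ?nnegrE // mulr_ge0 ?ler0n ?(ltW s_gt0).
  rewrite exprMn mulrC ler_wpM2r ?exprn_ge0 ?ler0n //.
  have -> : r%:R ^+ m = Num.sqrt r%:R ^+ (2 * m) :> R by rewrite exprM expr2 ss.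
  (* Rounding down still leaves n <= 2 m. *)
  by apply: ler_weXn2l => //; rewrite /m; lia.
apply: le_trans (ler_wpM2r (powR_ge0 _ _) Bn) _.
rewrite -mulrA ler_wpM2l ?exprn_ge0 ?ler0n //.
have q_neq0 : q%:R != 0 :> R by rewrite pnatr_eq0 -lt0n.
rewrite -!powR_mulrn ?ler0n // -powRD ?q_neq0 ?implybT //.
apply: ler_powR; first by rewrite ler1n.
(* The exponents of q on the left add up to n + n (n - 3) / 4 = n (n + 1) / 4, while 4 k m is at
   least (n + 1)^2 - 1. *)
have : (n.+1 * n <= 4 * (k * m))%N by rewrite /k /m; nia.
rewrite -(ler_nat R) !natrM -natr1; lra.
Qed.
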